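(* Let $M=(X,d)$ be a metric space and let $P=\{P_i\}_{i=1}^t$ be a temporal-sampling of $M$ of size $n$. There exists an $O(n^3)$-time algorithm which, given $P$, outputs pseudo-ultrametrics and labelings that form a $(\chi,\delta)$-temporal hierarchical clustering of $P$ for every pair $\chi,\delta\in\mathbb{R}_{\ge 0}$ such that $P$ admits a $(\chi,\delta)$-temporal hierarchical clustering.
   Context: A temporal-sampling of a metric space $M=(X,d)$ of length $t$ is a sequence $P=\{P_i\}_{i=1}^t$ of finite, non-empty subsets of $X$; its size is $n=\sum_i|P_i|$. $M[Q]=(Q,d|_Q)$ is the restriction of $M$ to $Q\subseteq X$; $\mathrm{B}_M(p,r)$ is the closed ball of radius $r$ about $p$ in $M$. A pseudo-ultrametric is a pseudometric $\mu$ with $\mu(u,v)\le\max\{\mu(u,w),\mu(w,v)\}$ for all $u,v,w$. For pseudometric spaces $U=(Y,d_U)$, $V=(Y,d_V)$ on the same finite set, $L^\infty(U,V)=\max_{p,p'\in Y}|d_U(p,p')-d_V(p,p')|$. Given a set $Q$ and $k\in\mathbb{N}$, a $k$-labeling of $Q$ is a function $L:Q\to 2^{[k]}$ such that $\{L(p):p\in Q\}$ is a partition of $[k]$. Two $k$-labelings $L_1$ of $Q_1\subseteq X$ and $L_2$ of $Q_2\subseteq X$ are $\delta$-contiguous if (1) for all $u\in Q_1$, $L_1(u)\subseteq\bigcup_{v\in \mathrm{B}_M(u,\delta)\cap Q_2}L_2(v)$, and (2) for all $v\in Q_2$, $L_2(v)\subseteq\bigcup_{u\in\mathrm{B}_M(v,\delta)\cap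 Q_1}L_1(u)$. A $(\chi,\delta)$-temporal hierarchical clustering of $P$ is a sequence of pseudo-ultrametric spaces $U_i=(P_i,\mu_i)$, $i\in[t]$, with $L^\infty(M[P_i],U_i)\le\chi$ for all $i$, together with a sequence of $k$-labelings $L_i$ of $P_i$, $i\in[t]$, for some $k\le n$, such that $L_i$ and $L_{i+1}$ are $\delta$-contiguous for every $i\in[t-1]$. The algorithm has access to the ambient distances $d$ between input points. *)

(* Defs.v *)
(* MathComp / MathComp-Analysis *)
From HB Require Import structures.
From mathcomp Require Import all_boot all_order all_algebra finmap.
From mathcomp Require Export boolp reals topology.

Set Implicit Arguments.
Unset Strict Implicit.
Unset Printing Implicit Defensive.

Import Order.TTheory GRing.Theory Num.Theory.
Local Open Scope fset_scope.
Local Open Scope ring_scope.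

(** * Temporal hierarchical clusterings *)

Section Clustering.
Variable R : realType.

Record pseudometric (Y : Type) (mu : Y -> Y -> R) : Prop := Pseudometric {
  pseudometric_ge0 : forall u v, 0 <= mu u v;
  pseudometric_xx : forall u, mu u u = 0;
  pseudometric_sym : forall u v, mu u v = mu v u;
  pseudometric_triangle : forall u v w, mu u v <= mu u w + mu w v
}.

Definition pseudo_ultrametric (Y : Type) (mu : Y -> Y -> R) : Prop :=
  pseudometric mu /\ forall u v w, mu u v <= Num.max (mu u w) (mu w v).

Definition Linfty (Y : finType) (dU dV : Y -> Y -> R) : R :=
  \big[Num.max/0]_(p : Y) \big[Num.max/0]_(q : Y) `|dU p q - dV p q|.

Variable M : metricType R.

Definition mrestr (Q : {fset M}) (p q : Q) : R := mdist (val p) (val q).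

(* The blocks L p form a partition of [k] as a family indexed by Q: they are
   nonempty, they cover [k], and distinct points have disjoint blocks.  MathComp's
   [partition] only sees the set of blocks, hence the injectivity. *)
Definition is_labeling (k : nat) (Q : {fset M}) (L : Q -> {set 'I_k}) : Prop :=
  partition [set L p | p : Q] [set: 'I_k] /\ injective L.

(* The condition [mdist u v <= delta] is membership in the closed ball of the
   metric; the library's [closed_ball] is the closure of the open ball, which
   may be smaller. *)
Definition contiguous (delta : R) (k : nat) (Q1 Q2 : {fset M})
    (L1 : Q1 -> {set 'I_k}) (L2 : Q2 -> {set 'I_k}) : Prop :=
  (forall u : Q1,
     L1 u \subset \bigcup_(v : Q2 | mdist (val u) (val v) <= delta) L2 v) /\
  (forall v : Q2,
     L2 v \subset \bigcup_(u : Q1 | mdist (val v) (val u) <= delta) L1 u).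

Definition temporal_sampling (t : nat) (P : 'I_t -> {fset M}) : Prop :=
  forall i, P i != fset0.

Definition sampling_size (t : nat) (P : 'I_t -> {fset M}) : nat :=
  (\sum_(i < t) #|` P i|)%N.

Definition temporal_hierarchical_clustering (chi delta : R)
    (t : nat) (P : 'I_t -> {fset M})
    (mu : forall i, P i -> P i -> R)
    (k : nat) (L : forall i, P i -> {set 'I_k}) : Prop :=
  [/\ forall i, pseudo_ultrametric (@mu i),
      forall i, Linfty (@mrestr (P i)) (@mu i) <= chi,
      (k <= sampling_size P)%N,
      forall i, is_labeling (@L i)
    & forall i j : 'I_t, j = i.+1 :> nat -> contiguous delta (@L i) (@L j)].

Definition admits_thc (chi delta : R) (t : nat) (P : 'I_t -> {fset M}) : Prop :=
  exists (mu : forall i, P i -> P i -> R) (k : nat)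
         (L : forall i, P i -> {set 'I_k}),
    temporal_hierarchical_clustering chi delta mu L.

End Clustering.

(** * A real random access machine

    Programs are finite pieces of syntax, independent of the input and without
    real constants other than the natural numbers.  The machine has two
    memories, one with integer (natural number) cells and one with real cells,
    each organized in arrays named by a natural number and addressed by three
    computed indices; scalar variables are cells with constant indices.  As
    usual for unit-cost machines, integers only support addition and
    (truncated) subtraction, reals support the field operations and
    comparisons, and there is no conversion (floor) from reals to integers.

    The input consists of the number [t] of levels, the number of points of
    each level, and the distance oracle: [RDist i a j b] is the distance of the
    [a]-th point of level [i] to the [b]-th point of level [j]. *)

Inductive nexp : Type :=
| NLit (n : nat)
| NLevels
| NSize (i : nexp)
| NCell (a : nat) (i j l : nexp)
| NAdd (e f : nexp)
| NSub (e f : nexp).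

Inductive rexp : Type :=
| RLit (n : nat)
| RDist (i a j b : nexp)
| RCell (a : nat) (i j l : nexp)
| RAdd (e f : rexp)
| RSub (e f : rexp)
| RMul (e f : rexp)
| RDiv (e f : rexp).

Inductive bexp : Type :=
| BNle (e f : nexp)
| BRle (e f : rexp)
| BNot (b : bexp)
| BAnd (b c : bexp).

Inductive cmd : Type :=
| Skip
| NSet (a : nat) (i j l : nexp) (e : nexp)
| RSet (a : nat) (i j l : nexp) (e : rexp)
| Seq (p q : cmd)
| If (b : bexp) (p q : cmd)
| While (b : bexp) (p : cmd).

(* Number of unit-time operations performed by the evaluation of an expression;
   the evaluation is strict, so that it only depends on the expression. *)
Fixpoint ncost (e : nexp) : nat :=
  match e with
  | NLit _ | NLevels => 1
  | NSize i => (ncost i).+1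
  | NCell _ i j l => (ncost i + ncost j + ncost l).+1
  | NAdd e f | NSub e f => (ncost e + ncost f).+1
  end%N.

Fixpoint rcost (e : rexp) : nat :=
  match e with
  | RLit _ => 1
  | RDist i a j b => (ncost i + ncost a + ncost j + ncost b).+1
  | RCell _ i j l => (ncost i + ncost j + ncost l).+1
  | RAdd e f | RSub e f | RMul e f | RDiv e f => (rcost e + rcost f).+1
  end%N.

Fixpoint bcost (b : bexp) : nat :=
  match b with
  | BNle e f => (ncost e + ncost f).+1
  | BRle e f => (rcost e + rcost f).+1
  | BNot b => (bcost b).+1
  | BAnd b c => (bcost b + bcost c).+1
  end%N.

Section Machine.
Variable R : realType.

Record input : Type := Input {
  in_levels : nat;
  in_size : nat -> nat;
  in_dist : nat -> nat -> nat -> nat -> R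
}.

Record state : Type := State {
  nmem : nat -> nat -> nat -> nat -> nat;
  rmem : nat -> nat -> nat -> nat -> R
}.

Definition init_state : state :=
  State (fun _ _ _ _ => 0%N) (fun _ _ _ _ => 0).

Definition upd (T : Type) (m : nat -> nat -> nat -> nat -> T)
    (a i j l : nat) (x : T) : nat -> nat -> nat -> nat -> T :=
  fun a' i' j' l' =>
    if [&& a' == a, i' == i, j' == j & l' == l] then x else m a' i' j' l'.

Section Semantics.
Variable I : input.

Fixpoint neval (s : state) (e : nexp) : nat :=
  match e with
  | NLit n => n
  | NLevels => in_levels I
  | NSize i => in_size I (neval s i)
  | NCell a i j l => nmem s a (neval s i) (neval s j) (neval s l)
  | NAdd e f => neval s e + neval s f
  | NSub e f => neval s e - neval s f
  end%N.

Fixpoint reval (s : state) (e : rexp) : R :=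
  match e with
  | RLit n => n%:R
  | RDist i a j b => in_dist I (neval s i) (neval s a) (neval s j) (neval s b)
  | RCell a i j l => rmem s a (neval s i) (neval s j) (neval s l)
  | RAdd e f => reval s e + reval s f
  | RSub e f => reval s e - reval s f
  | RMul e f => reval s e * reval s f
  | RDiv e f => reval s e / reval s f
  end.

Fixpoint beval (s : state) (b : bexp) : bool :=
  match b with
  | BNle e f => (neval s e <= neval s f)%N
  | BRle e f => reval s e <= reval s f
  | BNot b => ~~ beval s b
  | BAnd b c => beval s b && beval s c
  end.

(* [exec p s T s']: started in [s], [p] halts in [s'] after [T] time units. *)
Inductive exec : cmd -> state -> nat -> state -> Prop :=
| exec_skip s : exec Skip s 1 s
| exec_nset s a i j l e :
    exec (NSet a i j l e) s (ncost i + ncost j + ncost l + ncost e).+1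
      (State (upd (nmem s) a (neval s i) (neval s j) (neval s l) (neval s e))
             (rmem s))
| exec_rset s a i j l e :
    exec (RSet a i j l e) s (ncost i + ncost j + ncost l + rcost e).+1
      (State (nmem s)
             (upd (rmem s) a (neval s i) (neval s j) (neval s l) (reval s e)))
| exec_seq p q s T s' T' s'' :
    exec p s T s' -> exec q s' T' s'' -> exec (Seq p q) s (T + T').+1 s''
| exec_if b p q s T s' :
    exec (if beval s b then p else q) s T s' ->
    exec (If b p q) s (bcost b + T).+1 s'
| exec_while_false b p s :
    ~~ beval s b -> exec (While b p) s (bcost b).+1 s
| exec_while_true b p s T s' T' s'' :
    beval s b -> exec p s T s' -> exec (While b p) s' T' s'' ->
    exec (While b p) s (bcost b + T + T').+1 s''.

Lemma exec_deterministic p s T1 s1 T2 s2 :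
  exec p s T1 s1 -> exec p s T2 s2 -> T1 = T2 /\ s1 = s2.
Proof.
move=> H; elim: H T2 s2 => {p s T1 s1}.
- by move=> s T2 s2 H; inversion H.
- by move=> s a i j l e T2 s2 H; inversion H.
- by move=> s a i j l e T2 s2 H; inversion H.
- move=> p q s T s' T' s'' _ IHp _ IHq T2 s2 H.
  inversion H as [| | |? ? ? ? ? ? ? E1 E2| | |]; subst.
  by case: (IHp _ _ E1) => ? ?; subst; case: (IHq _ _ E2) => -> ->.
- move=> b p q s T s' _ IH T2 s2 H.
  inversion H as [| | | |? ? ? ? ? ? E| |]; subst.
  by case: (IH _ _ E) => -> ->.
- move=> b p s nb T2 s2 H.
  inversion H as [| | | | | |? ? ? ? ? ? ? tb]; subst => //.
  by rewrite tb in nb.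
- move=> b p s T s' T' s'' tb _ IHp _ IHw T2 s2 H.
  inversion H as [| | | | |? ? ? nb|? ? ? ? ? ? ? _ E1 E2]; subst.
    by rewrite tb in nb.
  by case: (IHp _ _ E1) => ? ?; subst; case: (IHw _ _ E2) => -> ->.
Qed.

End Semantics.

(** ** Encoding of samplings and decoding of clusterings *)

Variables (M : metricType R) (t : nat).

(* The finite sets of a sampling are presented as duplicate-free lists, in an
   arbitrary order. *)
Definition enumerates (pts : 'I_t -> seq M) (P : 'I_t -> {fset M}) : Prop :=
  forall i, uniq (pts i) /\ pts i =i P i.

Definition point_of (pts : 'I_t -> seq M) (i a : nat) : option M :=
  obind (fun i' : 'I_t => onth (pts i') a) (insub i).

(* Queries about points that do not exist are answered by 0. *)
Definition encode (pts : 'I_t -> seq M) : input := {|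
  in_levels := t;
  in_size := fun i => oapp (fun i' : 'I_t => size (pts i')) 0%N (insub i);
  in_dist := fun i a j b =>
    match point_of pts i a, point_of pts j b with
    | Some x, Some y => mdist x y
    | _, _ => 0
    end
|}.

(* The output is read in real array 0 (the pseudo-ultrametrics), in cell
   (0,0,0) of integer array 0 (the number of labels), and in integer array 1
   (the membership table of the labelings). *)
Definition out_mu (pts : 'I_t -> seq M) (P : 'I_t -> {fset M}) (s : state)
    (i : 'I_t) (p q : P i) : R :=
  rmem s 0 i (index (val p) (pts i)) (index (val q) (pts i)).

Definition out_k (s : state) : nat := nmem s 0 0 0 0.

Definition out_label (pts : 'I_t -> seq M) (P : 'I_t -> {fset M}) (s : state)
    (i : 'I_t) (p : P i) : {set 'I_(out_k s)} :=
  [set j : 'I_(out_k s) | nmem s 1 i (index (val p) (pts i)) j != 0%N].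

End Machine.

(* Main.v *)
(* Levels are treated separately for the metrics: if [m] is the bottleneck
   (minimax path) ultrametric of [d] on a level and [e] is half of the largest
   value of [d - m], then [m + e] off the diagonal is within [e] of [d].  Any
   pseudo-ultrametric within [chi] of [d] is at most [m + chi], so that
   [d <= m + 2 chi] and [e <= chi].  Bottlenecks are computed by the
   Floyd-Warshall recursion in cubic time.

   For the labels, contiguity forces every point of a level to be within
   [delta] of a point of each adjacent level.  Conversely, give each of the [n]
   points of the sampling its own label and let the label move, forwards and
   backwards in time, to a nearest point of the next level: every point is
   covered, and each move is at most any admissible [delta].  This needs
   quadratically many distance queries, and [k = n]. *)
Require Import Defs.
From mathcomp Require Import all_boot all_order all_algebra finmap.
From mathcomp Require Import zify lra.

Set Implicit Arguments.
Unset Strict Implicit.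
Unset Printing Implicit Defensive.

Import Order.TTheory GRing.Theory Num.Theory.
Local Open Scope ring_scope.

(** * Program logic *)

(** Only array names are recorded, not cells, so that frame conditions become membership tests on
    concrete lists, settled by computation. *)
Fixpoint nwrites (p : cmd) : seq nat :=
  match p with
  | NSet a _ _ _ _ => [:: a]
  | Seq p q | If _ p q => nwrites p ++ nwrites q
  | While _ p => nwrites p
  | _ => [::]
  end.

Fixpoint rwrites (p : cmd) : seq nat :=
  match p with
  | RSet a _ _ _ _ => [:: a]
  | Seq p q | If _ p q => rwrites p ++ rwrites q
  | While _ p => rwrites p
  | _ => [::]
  end.

Definition var (x : nat) : nexp := NCell x (NLit 0) (NLit 0) (NLit 0).

Definition assign (x : nat) (e : nexp) : cmd := NSet x (NLit 0) (NLit 0) (NLit 0) e.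

Definition incr (x : nat) : cmd := assign x (NAdd (var x) (NLit 1)).

Definition For (x : nat) (e : nexp) (p : cmd) : cmd :=
  Seq (assign x (NLit 0))
      (While (BNle (NAdd (var x) (NLit 1)) e) (Seq p (incr x))).

Section Logic.
Variables (R : realType) (I : input R).
Implicit Types (p q : cmd) (s : state R) (Q : state R -> Prop).

Definition agree (A B : seq nat) s s' : Prop :=
  (forall a i j l, a \notin A -> nmem s' a i j l = nmem s a i j l) /\
  (forall a i j l, a \notin B -> rmem s' a i j l = rmem s a i j l).

Lemma agree_trans A B A' B' s s' s'' :
  agree A B s s' -> agree A' B' s' s'' -> agree (A ++ A') (B ++ B') s s''.
Proof.
move=> [n1 r1] [n2 r2]; split=> a i j l; rewrite mem_cat negb_or => /andP[h1 h2].
  by rewrite n2 // n1.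
by rewrite r2 // r1.
Qed.

Lemma agree_sub A B A' B' s s' :
  {subset A <= A'} -> {subset B <= B'} -> agree A B s s' -> agree A' B' s s'.
Proof.
move=> sA sB [n1 r1]; split=> a i j l; move=> h.
  by rewrite n1 //; apply: contra h => /sA.
by rewrite r1 //; apply: contra h => /sB.
Qed.

Lemma exec_agree p s T s' : exec I p s T s' -> agree (nwrites p) (rwrites p) s s'.
Proof.
elim=> {p s T s'} //=.
- by move=> s a i j l e; split=> // a' i' j' l' /=; rewrite inE /upd => /negPf->.
- by move=> s a i j l e; split=> // a' i' j' l' /=; rewrite inE /upd => /negPf->.
- by move=> p q s T s' T' s'' _ h1 _ h2; exact: agree_trans h1 h2.
- move=> b p q s T s' _; case: ifP => _; apply: agree_sub => x;
    by rewrite mem_cat => ->; rewrite ?orbT.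
- move=> b p s T s' T' s'' _ _ h1 _ h2; have := agree_trans h1 h2.
  by apply: agree_sub => x; rewrite mem_cat orbb.
Qed.

Definition runs p s (T : nat) Q : Prop :=
  exists T' s', [/\ exec I p s T' s', (T' <= T)%N & Q s'].

(** The frame condition is derived from the syntax and handed to the new postcondition, so
    invariants need not mention untouched arrays. *)
Lemma runs_conseq p s T Q T' Q' :
  runs p s T Q -> (T <= T')%N ->
  (forall s', agree (nwrites p) (rwrites p) s s' -> Q s' -> Q' s') ->
  runs p s T' Q'.
Proof.
move=> [T0 [s' [h le q]]] leT QQ'; exists T0, s'; split=> //.
  exact: leq_trans leT.
by apply: QQ' => //; exact: exec_agree h.
Qed.

Lemma runs_nset s a i j l e Q :
  Q (State (upd (nmem s) a (neval I s i) (neval I s j) (neval I s l) (neval I s e))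
       (rmem s)) ->
  runs (NSet a i j l e) s (ncost i + ncost j + ncost l + ncost e).+1 Q.
Proof. by move=> q; do 2 eexists; split; first exact: exec_nset. Qed.

Lemma runs_rset s a i j l e Q :
  Q (State (nmem s)
       (upd (rmem s) a (neval I s i) (neval I s j) (neval I s l) (reval I s e))) ->
  runs (RSet a i j l e) s (ncost i + ncost j + ncost l + rcost e).+1 Q.
Proof. by move=> q; do 2 eexists; split; first exact: exec_rset. Qed.

Lemma runs_skip s Q : Q s -> runs Skip s 1 Q.
Proof. by move=> q; do 2 eexists; split; first exact: exec_skip. Qed.

Lemma runs_seq p q s T T' Q :
  runs p s T
    (fun s' => agree (nwrites p) (rwrites p) s s' -> runs q s' T' Q) ->
  runs (Seq p q) s (T + T').+1 Q.
Proof.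
move=> [T1 [s1 [h1 le1 hq]]].
have [T2 [s2 [h2 le2 hQ]]] := hq (exec_agree h1).
exists (T1 + T2).+1, s2; split=> //; first exact: exec_seq h1 h2.
by rewrite ltnS leq_add.
Qed.

(** Charging both branches instead of the costlier one keeps budgets free of maxima and only affects
    constants. *)
Lemma runs_if b p q s T T' Q :
  (beval I s b -> runs p s T Q) -> (~~ beval I s b -> runs q s T' Q) ->
  runs (If b p q) s (bcost b + (T + T')).+1 Q.
Proof.
move=> hp hq; have [hb|hb] := boolP (beval I s b).
  have [T1 [s1 [h1 le1 hQ]]] := hp hb.
  exists (bcost b + T1).+1, s1; split=> //; first by apply: exec_if; rewrite hb.
  by rewrite ltnS leq_add2l (leq_trans le1) ?leq_addr.
have [T1 [s1 [h1 le1 hQ]]] := hq hb.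
exists (bcost b + T1).+1, s1; split=> //.
  by apply: exec_if; rewrite (negPf hb).
by rewrite ltnS leq_add2l (leq_trans le1) ?leq_addl.
Qed.

Definition setn s x v : state R := State (upd (nmem s) x 0 0 0 v) (rmem s).

Lemma agree_setn s x v A B : x \in A -> agree A B s (setn s x v).
Proof.
move=> xA; split=> // a i j l; rewrite /= /upd; have [->|] := eqVneq a x => //.
by rewrite xA.
Qed.

(* The overhead [ncost e + 20] per iteration pays for the test and the
   increment; since [0 < b k] it is absorbed in the constant factor. *)
Lemma runs_for x e p s N C (b : nat -> nat) (J : nat -> state R -> Prop) :
  x \notin nwrites p ->
  (forall k, (k < N)%N -> (0 < b k)%N) ->
  (forall s1, agree (x :: nwrites p) (rwrites p) s s1 -> neval I s1 e = N) ->
  (forall k s1 v, J k s1 -> J k (setn s1 x v)) ->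
  J 0%N s ->
  (forall k s1, (k < N)%N -> agree (x :: nwrites p) (rwrites p) s s1 ->
     nmem s1 x 0 0 0 = k -> J k s1 -> runs p s1 (C * b k) (J k.+1)) ->
  runs (For x e p) s ((C + (ncost e + 20)) * (\sum_(k < N) b k) + (ncost e + 20))
    (J N).
Proof.
move=> xp b0 eN Jset J0 Jstep.
(* Induction on the number [n] of iterations still to run; the final [ncost e + 10] pays for the
   failing test. *)
have loop n k s1 : (n + k = N)%N -> agree (x :: nwrites p) (rwrites p) s s1 ->
    nmem s1 x 0 0 0 = k -> J k s1 ->
    runs (While (BNle (NAdd (var x) (NLit 1)) e) (Seq p (incr x))) s1
      ((C + (ncost e + 20)) * (\sum_(k <= k' < N) b k') + (ncost e + 10)) (J N).
  elim: n k s1 => [|n IH] k s1 nk ag xk Jk.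
    rewrite add0n in nk; rewrite nk in xk Jk.
    exists (bcost (BNle (NAdd (var x) (NLit 1)) e)).+1, s1; split=> //.
      by apply: exec_while_false; rewrite /= xk (eN _ ag) addn1 ltnn.
    by rewrite /=; lia.
  have kN : (k < N)%N by lia.
  have [T2 [s2 [h2 le2 J2]]] := Jstep k s1 kN ag xk Jk.
  have ag2 := exec_agree h2.
  have xk2 : nmem s2 x 0 0 0 = k by rewrite (ag2.1 _ _ _ _ xp).
  have hi : exec I (incr x) s2 10 (setn s2 x k.+1).
    have := exec_nset I s2 x (NLit 0) (NLit 0) (NLit 0) (NAdd (var x) (NLit 1)).
    by rewrite /= xk2 (addn1 k).
  have ag3 : agree (x :: nwrites p) (rwrites p) s (setn s2 x k.+1).
    have := agree_trans ag (agree_trans ag2 (exec_agree hi)).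
    apply: agree_sub => y; rewrite !(mem_cat, inE) /=;
      by [case: (y == x); case: (y \in _) | case: (y \in _)].
  have [||T4 [s4 [h4 le4 J4]]] := IH k.+1 _ _ ag3 _ (Jset _ _ _ J2); first by lia.
    by rewrite /= /upd !eqxx.
  exists (bcost (BNle (NAdd (var x) (NLit 1)) e) + (T2 + 10).+1 + T4).+1, s4; split=> //.
    apply: exec_while_true h4; last exact: exec_seq h2 hi.
    by rewrite /= xk (eN _ ag) addn1.
  rewrite [\sum_(k <= _ < _) _]big_ltn //=.
  rewrite mulnDr; move: le2 le4 (b0 k kN); set S := (_ * \sum_(_ <= _ < _) _)%N.
  by case: (b k) => // n0; rewrite !mulnDl !mulnS; lia.
have [] := loop N 0%N (setn s x 0); rewrite ?addn0 //=.
- by apply: agree_setn; rewrite mem_head.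
- by rewrite /= /upd !eqxx.
- exact: Jset.
- rewrite big_mkord => T [s1 [h1 le1 JN]].
  exists (5 + T).+1, s1; split=> //; last by move: le1; set S := (_ * _)%N; lia.
  by apply: exec_seq h1; exact: (exec_nset I s x (NLit 0) (NLit 0) (NLit 0) (NLit 0)).
Qed.

(** With at least one iteration the additive overhead is absorbed in the factor, so the bound has
    the form required of the body of an enclosing loop. *)
Lemma runs_for_pos x e p s N C (b : nat -> nat) (J : nat -> state R -> Prop) :
  x \notin nwrites p ->
  (0 < N)%N ->
  (forall k, (k < N)%N -> (0 < b k)%N) ->
  (forall s1, agree (x :: nwrites p) (rwrites p) s s1 -> neval I s1 e = N) ->
  (forall k s1 v, J k s1 -> J k (setn s1 x v)) ->
  J 0%N s ->
  (forall k s1, (k < N)%N -> agree (x :: nwrites p) (rwrites p) s s1 ->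
     nmem s1 x 0 0 0 = k -> J k s1 -> runs p s1 (C * b k) (J k.+1)) ->
  runs (For x e p) s ((C + (ncost e + 20) * 2) * (\sum_(k < N) b k)) (J N).
Proof.
move=> xp N0 b0 eN Jset J0 Jstep.
apply: runs_conseq (runs_for xp b0 eN Jset J0 Jstep) _ (fun _ _ h => h).
have : (0 < \sum_(k < N) b k)%N.
  case: N N0 b0 {eN J0 Jstep} => // N _ b0.
  by rewrite big_ord_recl (leq_trans (b0 0%N _)) ?leq_addr.
by case: (\sum_(k < N) b k)%N => // m _; lia.
Qed.

(** The invariant advances lexicographically, a full row being the start of the next one. Each loop
    adds twice the overhead [ncost e + 20], whence the factor 4. *)
Lemma runs_for2 x y e p s N C (J : nat -> nat -> state R -> Prop) :
  x != y -> x \notin nwrites p -> y \notin nwrites p ->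
  (0 < N)%N ->
  (forall s1, agree (x :: y :: nwrites p) (rwrites p) s s1 -> neval I s1 e = N) ->
  (forall a b s1 v, J a b s1 -> J a b (setn s1 x v)) ->
  (forall a b s1 v, J a b s1 -> J a b (setn s1 y v)) ->
  (forall a s1, J a N s1 -> J a.+1 0%N s1) ->
  J 0%N 0%N s ->
  (forall a b s1, (a < N)%N -> (b < N)%N ->
     agree (x :: y :: nwrites p) (rwrites p) s s1 ->
     nmem s1 x 0 0 0 = a -> nmem s1 y 0 0 0 = b ->
     J a b s1 -> runs p s1 C (J a b.+1)) ->
  runs (For x e (For y e p)) s ((C + (ncost e + 20) * 4) * (N * N)) (J N 0%N).
Proof.
move=> xy xp yp N0 eN Jx Jy Jn J0 Jstep.
have xyp : x \notin nwrites (For y e p) by rewrite /= cats1 !(mem_rcons, inE) !negb_or xy.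
have sub z : z \in x :: nwrites (For y e p) -> z \in x :: y :: nwrites p.
  by rewrite /= !(mem_cat, inE); do ?case: eqP => //=; rewrite orbF.
have subr z : z \in rwrites (For y e p) -> z \in rwrites p.
  by rewrite /= mem_cat orbF.
apply: runs_conseq (runs_for_pos (C := C + (ncost e + 20) * 2) (b := fun=> N)
  (J := fun a s1 => J a 0%N s1) xyp N0 (fun _ _ => N0) _ _ J0 _) _ (fun _ _ h => h).
- by move=> s1 ag; apply: eN; exact: agree_sub ag.
- by move=> k s1 v; exact: Jx.
- move=> a s1 aN ag xa Ja.
  apply: runs_conseq (runs_for_pos (C := C) (b := fun=> 1%N)
    (J := fun b s1 => J a b s1) yp N0 _ _ _ Ja _) _ _ => //.
  + move=> s2 ag2; apply: eN; have := agree_trans ag ag2.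
    apply: agree_sub => z; rewrite mem_cat => /orP[].
    * exact: sub.
    * by move=> h; rewrite inE h orbT.
    * exact: subr.
    * by [].
  + by move=> k s2 v; exact: Jy.
  + move=> b s2 bN ag2 yb Jb; rewrite muln1; apply: Jstep => //.
      have := agree_trans ag ag2; apply: agree_sub => z; rewrite mem_cat => /orP[].
      * exact: sub.
      * by move=> h; rewrite inE h orbT.
      * exact: subr.
      * by [].
    by rewrite (ag2.1 x) // inE negb_or xy.
  + by rewrite sum_nat_const card_ord muln1.
  + by move=> s2 _; exact: Jn.
- by rewrite sum_nat_const card_ord; apply: leq_mul => //; lia.
Qed.

(** The step may use that all layers other than [i0] keep their initial values; this is how one
    layer is computed from another of the same array. *)
Lemma runs_fill2 x y e arr i0 p s N C (f : nat -> nat -> R) :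
  x != y -> x \notin nwrites p -> y \notin nwrites p ->
  (0 < N)%N ->
  (forall s1, agree (x :: y :: nwrites p) (rwrites p) s s1 -> neval I s1 e = N) ->
  (forall a b s1, (a < N)%N -> (b < N)%N ->
     agree (x :: y :: nwrites p) (rwrites p) s s1 ->
     nmem s1 x 0 0 0 = a -> nmem s1 y 0 0 0 = b ->
     (forall i j l, i != i0 -> rmem s1 arr i j l = rmem s arr i j l) ->
     runs p s1 C (fun s2 => forall i j l,
       rmem s2 arr i j l = upd (rmem s1) arr i0 a b (f a b) arr i j l)) ->
  runs (For x e (For y e p)) s ((C + (ncost e + 20) * 4) * (N * N))
    (fun s2 => forall i j l, rmem s2 arr i j l =
       if [&& i == i0, j < N & l < N]%N then f j l else rmem s arr i j l).
Proof.
move=> xy xp yp N0 eN step.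
apply: runs_conseq (runs_for2 (J := fun a b s1 => forall i j l, rmem s1 arr i j l =
    if [&& i == i0, (j < a) || (j == a) && (l < b) & l < N]%N then f j l
    else rmem s arr i j l) xy xp yp N0 eN _ _ _ _ _) _ _ => //.
- move=> a s1 J1 i j l; rewrite J1 andbF orbF ltnS [(j <= a)%N]leq_eqVlt.
  by case: (l < N)%N; rewrite !(andbT, andbF) // orbC.
- by move=> i j l; rewrite !ltn0 andbF andbF.
- move=> a b s1 aN bN ag xa yb Jab.
  apply: runs_conseq (step a b s1 aN bN ag xa yb _) _ _ => //.
    by move=> i j l /negPf ii0; rewrite Jab ii0.
  move=> s2 _ h i j l; rewrite h /upd eqxx /= Jab.
  case: (i == i0) => //=; rewrite ltnS [(l <= b)%N]leq_eqVlt.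
  have [->|] := eqVneq j a; rewrite ?ltnn ?orbF ?orFb //=.
  by have [->|] := eqVneq l b; rewrite ?bN.
- by move=> s2 _ h i j l; rewrite h andbF orbF.
Qed.
End Logic.
(** * The ultrametrics *)

(** Floyd-Warshall with minimum and maximum: the least possible longest edge of a path from [a] to
    [b] whose inner points are below [c]. *)
Definition bneck (R : realType) (d : nat -> nat -> R) (c : nat) : nat -> nat -> R :=
  iteri c (fun c m a b => Num.min (m a b) (Num.max (m a c) (m c b))) d.

(** The nested folds follow the order of the two program loops. *)
Definition distortion (R : realType) (d : nat -> nat -> R) (n : nat) : R :=
  iteri n (fun a e => iteri n (fun b e => Num.max e ((d a b - bneck d n a b) / 2)) e) 0.

Definition ultra (R : realType) (d : nat -> nat -> R) (n a b : nat) : R :=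
  if a == b then 0 else bneck d n a b + distortion d n.

Notation zero := (NLit 0).
(* Loop variables: 10 is the current level, 11 a point of it; 12 and 13 are
   inner variables.  Real array 1 holds the layers of [bneck] of the current
   level, 2 its distortion, and 3 is scratch.  Integer array 2 is the table of
   nearest points; 3 and 4 hold the forward and backward track of the current
   label, and the output cell 0 counts the labels already placed. *)
Notation lvl := (var 10).
Notation pa := (var 11).
Notation pb := (var 12).
Notation piv := (var 13).

Definition init_bneck : cmd :=
  For 11 (NSize lvl) (For 12 (NSize lvl) (RSet 1 zero pa pb (RDist lvl pa lvl pb))).

(** Each round writes a fresh layer, so the values of the previous round stay readable. The scratch
    cell holds the maximum over the two legs. *)
Definition bneck_step : cmd :=
  Seq (If (BRle (RCell 1 piv pa piv) (RCell 1 piv piv pb))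
        (RSet 3 zero zero zero (RCell 1 piv piv pb))
        (RSet 3 zero zero zero (RCell 1 piv pa piv)))
      (If (BRle (RCell 1 piv pa pb) (RCell 3 zero zero zero))
        (RSet 1 (NAdd piv (NLit 1)) pa pb (RCell 1 piv pa pb))
        (RSet 1 (NAdd piv (NLit 1)) pa pb (RCell 3 zero zero zero))).

Definition all_bneck : cmd :=
  For 13 (NSize lvl) (For 11 (NSize lvl) (For 12 (NSize lvl) bneck_step)).

Definition distortion_step : cmd :=
  let e := RDiv (RSub (RDist lvl pa lvl pb) (RCell 1 (NSize lvl) pa pb)) (RLit 2) in
  If (BRle (RCell 2 zero zero zero) e) (RSet 2 zero zero zero e) Skip.

Definition all_distortion : cmd :=
  Seq (RSet 2 zero zero zero (RLit 0))
      (For 11 (NSize lvl) (For 12 (NSize lvl) distortion_step)).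

Definition out_ultra : cmd :=
  For 11 (NSize lvl) (For 12 (NSize lvl)
    (If (BAnd (BNle pa pb) (BNle pb pa))
       (RSet 0 lvl pa pb (RLit 0))
       (RSet 0 lvl pa pb (RAdd (RCell 1 (NSize lvl) pa pb) (RCell 2 zero zero zero))))).

Definition ultra_level : cmd :=
  Seq init_bneck (Seq all_bneck (Seq all_distortion out_ultra)).

(** Turns the fixed cost of straight-line commands into a multiple of a positive loop weight. *)
Lemma cost_absorb x C m : (0 < m)%N -> ((x + C * m).+1 <= (x + C + 1) * m)%N.
Proof. by case: m => // m _; rewrite !mulnDl !mulnS; lia. Qed.

Lemma cost_absorb2 x y C m : (0 < m)%N ->
  ((x + (y + C * m).+1).+1 <= (x + y + C + 2) * m)%N.
Proof. by case: m => // m _; rewrite !mulnDl !mulnS; lia. Qed.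

Lemma cost_absorb3 x C C' m : (0 < m)%N ->
  ((C * m + (C' * m + x).+1).+1 <= (C + C' + x + 2) * m)%N.
Proof. by case: m => // m _; rewrite !mulnDl !mulnS; lia. Qed.

Definition slice (R : realType) (I : input R) (i a b : nat) : R := in_dist I i a i b.

(** * Result and running time of the ultrametric computation on one level *)

Section UltraLevel.
Variable R : realType.
Implicit Types (I : input R) (s : state R).

(** Here and below the constant is left open and read off from the loop rules; being chosen before
    the input, it is uniform. *)
Lemma runs_init_bneck : exists C, forall I i n s,
  (0 < n)%N -> in_size I i = n -> nmem s 10 0 0 0 = i ->
  runs I init_bneck s (C * (n * n)) (fun s' =>
    forall a b, (a < n)%N -> (b < n)%N -> rmem s' 1 0 a b = slice I i a b).
Proof.
eexists=> I i n s n_gt0 in_n si; apply: runs_conseq (runs_fill2 (arr := 1) (i0 := 0) (f := slice I i)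
  _ _ _ n_gt0 _ _) _ _ => //.
- by move=> s1 ag; rewrite /= (ag.1 10%N) // si.
- move=> a b s1 an bn ag xa yb _; apply: runs_rset => /= i' j l.
  by rewrite (ag.1 10%N) // si xa yb.
- by move=> s' _ h a b an bn; rewrite h an bn.
Qed.

Lemma runs_all_bneck : exists C, forall I i n s,
  (0 < n)%N -> in_size I i = n -> nmem s 10 0 0 0 = i ->
  (forall a b, (a < n)%N -> (b < n)%N -> rmem s 1 0 a b = slice I i a b) ->
  runs I all_bneck s (C * (n * n * n)) (fun s' =>
    forall a b, (a < n)%N -> (b < n)%N -> rmem s' 1 n a b = bneck (slice I i) n a b).
Proof.
eexists=> I i n s n_gt0 in_n si s0; apply: runs_conseq (runs_for_pos (b := fun=> (n * n)%N)
  (J := fun c s' => forall a b, (a < n)%N -> (b < n)%N -> rmem s' 1 c a b = bneck (slice I i) c a b)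
  _ n_gt0 _ _ _ _ _) _ _ => //.
- by move=> _ _; rewrite muln_gt0 n_gt0.
- by move=> s1 ag; rewrite /= (ag.1 10%N) // si.
- move=> c s1 cn ag xc Jc.
  apply: runs_conseq (runs_fill2 (arr := 1) (i0 := c.+1) (f := bneck (slice I i) c.+1)
    _ _ _ n_gt0 _ _) _ _ => //.
  + by move=> s2 ag2; rewrite /= (ag2.1 10%N) // (ag.1 10%N) // si.
  + move=> a b s2 an bn ag2 xa yb far.
    have xc2 : nmem s2 13 0 0 0 = c by rewrite (ag2.1 13%N).
    (* Layer [c] is intact while layer [c.+1] is being written. *)
    have Jc2 a' b' : (a' < n)%N -> (b' < n)%N -> rmem s2 1 c a' b' = bneck (slice I i) c a' b'.
      by move=> ? ?; rewrite far ?Jc //; rewrite neq_ltn ltnSn.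
    apply: (runs_seq (Q := _)).
    apply: (runs_if (Q := _)) => /=; rewrite xc2 xa yb !Jc2 // => cmp.
      apply: runs_rset => ag3.
      apply: (runs_if (Q := _)) => /=; rewrite /upd /= xc2 xa yb !Jc2 // => cmp2.
        apply: runs_rset => i' j l /=.
        by rewrite xc2 xa yb !Jc2 // /upd /= addn1 (max_r cmp) (min_l cmp2).
      apply: runs_rset => i' j l; rewrite /upd /= /upd /= xc2 xa yb ?Jc2 // addn1.
      by rewrite -ltNge in cmp2; rewrite (max_r cmp) (min_r (ltW cmp2)).
    apply: runs_rset => ag3; rewrite -ltNge in cmp.
    apply: (runs_if (Q := _)) => /=; rewrite /upd /= xc2 xa yb !Jc2 // => cmp2.
      apply: runs_rset => i' j l /=.
      by rewrite xc2 xa yb !Jc2 // /upd /= addn1 (max_l (ltW cmp)) (min_l cmp2).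
    apply: runs_rset => i' j l; rewrite /upd /= /upd /= xc2 xa yb ?Jc2 // addn1.
    by rewrite -ltNge in cmp2; rewrite (max_l (ltW cmp)) (min_r (ltW cmp2)).
  + by move=> s2 _ h a b an bn; rewrite h eqxx an bn.
- by rewrite sum_nat_const card_ord -!mulnA; exact: leqnn.
Qed.

Lemma runs_all_distortion : exists C, forall I i n s,
  (0 < n)%N -> in_size I i = n -> nmem s 10 0 0 0 = i ->
  (forall a b, (a < n)%N -> (b < n)%N -> rmem s 1 n a b = bneck (slice I i) n a b) ->
  runs I all_distortion s (C * (n * n)) (fun s' => rmem s' 2 0 0 0 = distortion (slice I i) n).
Proof.
eexists=> I i n s n_gt0 in_n si sW; pose g a b := (slice I i a b - bneck (slice I i) n a b) / 2.
(* The accumulator in the midst of a row: the invariant is the nested fold cut after [b] entries of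
   row [a]. *)
pose row a (e : R) m := iteri m (fun b e => Num.max e (g a b)) e.
apply: runs_conseq (runs_seq (Q := _) _) _ (fun _ _ h => h).
  apply: runs_rset => ag0.
  apply: (runs_conseq (runs_for2 (J := fun a b s' =>
    rmem s' 2 0 0 0 = row a (iteri a (fun a e => row a e n) 0) b)
    _ _ _ n_gt0 _ _ _ _ _ _) (leqnn _)) => //.
  - by move=> s1 ag; rewrite /= (ag.1 10%N) // (ag0.1 10%N) // si.
  - move=> a b s1 an bn ag xa yb Jab.
    have s1i : nmem s1 10 0 0 0 = i by rewrite (ag.1 10%N) // (ag0.1 10%N).
    have Wab : rmem s1 1 n a b = bneck (slice I i) n a b by rewrite (ag.2 1%N) // (ag0.2 1%N) // sW.
    apply: (runs_if (Q := _)) => /=; rewrite s1i xa yb in_n Wab Jab => cmp.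
      by apply: runs_rset; rewrite /= s1i xa yb in_n Wab /upd /= (max_r cmp).
    by apply: runs_skip; rewrite -ltNge in cmp; rewrite Jab /= (max_l (ltW cmp)).
by apply: cost_absorb; rewrite muln_gt0 n_gt0.
Qed.

Lemma runs_out_ultra : exists C, forall I i n s,
  (0 < n)%N -> in_size I i = n -> nmem s 10 0 0 0 = i ->
  (forall a b, (a < n)%N -> (b < n)%N -> rmem s 1 n a b = bneck (slice I i) n a b) ->
  rmem s 2 0 0 0 = distortion (slice I i) n ->
  runs I out_ultra s (C * (n * n)) (fun s' => forall i' a b,
    rmem s' 0 i' a b =
      if [&& i' == i, a < n & b < n]%N then ultra (slice I i) n a b else rmem s 0 i' a b).
Proof.
eexists=> I i n s n_gt0 in_n si sW sD.
apply: runs_conseq (runs_fill2 (arr := 0) (i0 := i) (f := ultra (slice I i) n)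
  _ _ _ n_gt0 _ _) _ _ => //.
- by move=> s1 ag; rewrite /= (ag.1 10%N) // si.
- move=> a b s1 an bn ag xa yb _.
  have s1i : nmem s1 10 0 0 0 = i by rewrite (ag.1 10%N).
  have Wab : rmem s1 1 n a b = bneck (slice I i) n a b by rewrite (ag.2 1%N) // sW.
  have Dab : rmem s1 2 0 0 0 = distortion (slice I i) n by rewrite (ag.2 2%N) // sD.
  rewrite /ultra eqn_leq; apply: (runs_if (Q := _)) => /=; rewrite xa yb => cmp;
    apply: runs_rset => i' j l /=; rewrite s1i xa yb ?in_n ?Wab ?Dab ?cmp //.
  by rewrite (negPf cmp).
Qed.

Lemma runs_ultra_level : exists C, forall I i n s,
  (0 < n)%N -> in_size I i = n -> nmem s 10 0 0 0 = i ->
  runs I ultra_level s (C * (n * n * n)) (fun s' => forall i' a b,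
    rmem s' 0 i' a b =
      if [&& i' == i, a < n & b < n]%N then ultra (slice I i) n a b else rmem s 0 i' a b).
Proof.
have [C1 h1] := runs_init_bneck; have [C2 h2] := runs_all_bneck.
have [C3 h3] := runs_all_distortion; have [C4 h4] := runs_out_ultra.
exists (C1 + C2 + C3 + C4 + 3)%N => I i n s n_gt0 in_n si.
(* The quadratic stages are absorbed in the cubic one; the summand 3 pays for the three
   sequencings. *)
have C_le : ((C1 * (n * n) + (C2 * (n * n * n) + (C3 * (n * n) + C4 * (n * n)).+1).+1).+1
    <= (C1 + C2 + C3 + C4 + 3) * (n * n * n))%N.
  have : (n * n <= n * n * n)%N by rewrite leq_pmulr.
  have : (0 < n * n * n)%N by rewrite !muln_gt0 n_gt0.
  by nia.
apply: runs_conseq (runs_seq (Q := _) _) C_le (fun _ _ h => h).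
apply: runs_conseq (h1 I i n s n_gt0 in_n si) (leqnn _) _ => s1 ag1 W1 _.
have s1i : nmem s1 10 0 0 0 = i by rewrite (ag1.1 10%N).
apply: runs_seq; apply: runs_conseq (h2 I i n s1 n_gt0 in_n s1i W1) (leqnn _) _ => s2 ag2 W2 _.
have s2i : nmem s2 10 0 0 0 = i by rewrite (ag2.1 10%N).
apply: runs_seq; apply: runs_conseq (h3 I i n s2 n_gt0 in_n s2i W2) (leqnn _) _ => s3 ag3 D3 _.
have s3i : nmem s3 10 0 0 0 = i by rewrite (ag3.1 10%N).
have W3 a b : (a < n)%N -> (b < n)%N -> rmem s3 1 n a b = bneck (slice I i) n a b.
  by move=> an bn; rewrite (ag3.2 1%N) // W2.
apply: runs_conseq (h4 I i n s3 n_gt0 in_n s3i W3 D3) (leqnn _) _ => s4 _ h i' a b.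
by rewrite h (ag3.2 0%N) // (ag2.2 0%N) // (ag1.2 0%N).
Qed.
End UltraLevel.
(** * The labels *)

(** The default 0 is also the first candidate, so the fold returns a valid index as soon as [n] is
    positive. *)
Definition argmin (R : realType) (f : nat -> R) (n : nat) : nat :=
  iteri n (fun b x => if f x <= f b then x else b) 0%N.

Lemma argminP (R : realType) (f : nat -> R) n : (0 < n)%N ->
  (argmin f n < n)%N /\ forall b, (b < n)%N -> f (argmin f n) <= f b.
Proof.
elim: n => // -[_ _|n /(_ isT)[lt_n min_n] _].
  by rewrite /argmin /= lexx; split=> // -[].
rewrite /argmin [iteri _.+1 _ _]iteriS -/(argmin f n.+1).
case: ifPn => [le|]; last rewrite -ltNge => lt; split=> //.
- exact: leqW.
- by move=> b; rewrite ltnS leq_eqVlt => /orP[/eqP->|/min_n].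
- move=> b; rewrite ltnS leq_eqVlt => /orP[/eqP->//|/min_n le].
  exact: le_trans (ltW lt) le.
Qed.

Section Track.
Variable nt : nat -> nat -> nat -> nat.

Definition forth (i a m : nat) : nat :=
  iteri m (fun m x => nt (i + m) x (i + m.+1)) a.

(** After more than [i] hops the truncated subtraction stays at level 0; [track] only asks for
    [i - j] hops. *)
Definition back (i a m : nat) : nat :=
  iteri m (fun m x => nt (i - m) x (i - m.+1)) a.

Definition track (i a j : nat) : nat :=
  if (i <= j)%N then forth i a (j - i) else back i a (i - j).

End Track.

(** The table cell itself is the accumulator of the search. *)
Definition near_step : cmd :=
  If (BRle (RDist lvl pa piv (NCell 2 lvl pa piv)) (RDist lvl pa piv pb))
     Skip (NSet 2 lvl pa piv pb).

Definition near_level : cmd :=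
  For 11 (NSize lvl) (For 13 NLevels
    (Seq (NSet 2 lvl pa piv zero) (For 12 (NSize piv) near_step))).

Notation label := (NCell 0 zero zero zero).

(** Both tracks make as many hops as there are levels, wherever the label starts; [mark_point] does
    not read the values stored beyond the first or last level. *)
Definition track_point : cmd :=
  Seq (NSet 3 zero zero zero pa) (Seq (NSet 4 zero zero zero pa)
    (For 12 NLevels
      (Seq (NSet 3 (NAdd pb (NLit 1)) zero zero
             (NCell 2 (NAdd lvl pb) (NCell 3 pb zero zero) (NAdd lvl (NAdd pb (NLit 1)))))
           (NSet 4 (NAdd pb (NLit 1)) zero zero
             (NCell 2 (NSub lvl pb) (NCell 4 pb zero zero) (NSub lvl (NAdd pb (NLit 1)))))))).

Definition mark_point : cmd :=
  For 13 NLevels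
    (If (BNle lvl piv) (NSet 1 piv (NCell 3 (NSub piv lvl) zero zero) label (NLit 1))
                       (NSet 1 piv (NCell 4 (NSub lvl piv) zero zero) label (NLit 1))).

Definition all_labels : cmd :=
  For 10 NLevels (For 11 (NSize lvl)
    (Seq track_point (Seq mark_point (NSet 0 zero zero zero (NAdd label (NLit 1)))))).

Definition near (R : realType) (I : input R) (i a j : nat) : nat :=
  argmin (in_dist I i a j) (in_size I j).

(** * Result and running time of the nearest-point table and of the tracks *)

Section Labels.
Variable R : realType.
Implicit Types (I : input R) (s : state R).

Lemma runs_near_level : exists C, forall I i s,
  (0 < in_levels I)%N -> (forall i, (i < in_levels I)%N -> (0 < in_size I i)%N) ->
  (i < in_levels I)%N -> nmem s 10 0 0 0 = i ->
  runs I near_level s (C * (in_size I i * \sum_(j < in_levels I) in_size I j)) (fun s' =>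
    forall i' a j, if i' == i then
      (a < in_size I i)%N && (j < in_levels I)%N -> nmem s' 2 i' a j = near I i' a j
    else nmem s' 2 i' a j = nmem s 2 i' a j).
Proof.
eexists=> I i s; set t := in_levels I; set n := (\sum_(j < _) _)%N => t_gt0 sz_gt0 it si.
(* On level [i] the table is certified on [dom] only; the other levels keep their entries. *)
pose P (dom : nat -> nat -> bool) s' := forall i' a j,
  if i' == i then dom a j -> nmem s' 2 i' a j = near I i' a j
  else nmem s' 2 i' a j = nmem s 2 i' a j.
have P_sub (dom dom' : nat -> nat -> bool) s1 :
    (forall a j, dom a j -> dom' a j) -> P dom' s1 -> P dom s1.
  move=> sub Ps i' a j; move: (Ps i' a j); case: ifP => // _ h /sub.
  exact: h.
have P_upd dom s1 s2 a j v : ~~ dom a j -> P dom s1 ->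
    (forall i' a' j', nmem s2 2 i' a' j' = upd (nmem s1) 2 i a j v 2 i' a' j') -> P dom s2.
  move=> ndom Ps e i' a' j'; move: (Ps i' a' j'); rewrite e /upd eqxx /=.
  case: (i' == i) => //= h daj; case: ifP => [/andP[/eqP ea /eqP ej]|_]; last exact: h.
  by rewrite -ea -ej daj in ndom.
have n_gt0 : (0 < n)%N.
  by rewrite /n (bigD1 (Ordinal it)) //= ltn_addr // sz_gt0.
pose dom a a' j' := (a' < a)%N && (j' < t)%N.
pose domj a j a' j' := dom a a' j' || (a' == a) && (j' < j)%N.
apply: runs_conseq (runs_for_pos (b := fun=> n) (J := fun a s' => P (dom a) s')
  _ (sz_gt0 i it) _ _ _ _ _) _ _ => //.
- by move=> s1 ag; rewrite /= (ag.1 10%N) // si.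
- by move=> i' a' j'; case: eqP.
- move=> a s1 a_lt ag xa Ja.
  have s1i : nmem s1 10 0 0 0 = i by rewrite (ag.1 10%N).
  apply: runs_conseq (runs_for_pos (b := in_size I) (J := fun j s' => P (domj a j) s')
    _ t_gt0 sz_gt0 _ _ _ _) _ _ => //.
  + by apply: P_sub Ja => a' j'; rewrite /domj ltn0 andbF orbF.
  + move=> j s2 jt ag2 zj Jj.
    have s2i : nmem s2 10 0 0 0 = i by rewrite (ag2.1 10%N).
    have s2a : nmem s2 11 0 0 0 = a by rewrite (ag2.1 11%N).
    (* The cell under search is not yet certified, so it may be overwritten until its minimum is
       final. *)
    have ndom : ~~ domj a j a j by rewrite /domj /dom !ltnn andbF.
    apply: runs_conseq (runs_seq (Q := _) _) _ (fun _ _ h => h).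
      apply: runs_nset => /=; rewrite s2i s2a zj => ag3.
      apply: runs_conseq (runs_for_pos (b := fun=> 1%N) (J := fun b s' => P (domj a j) s' /\
        nmem s' 2 i a j = argmin (in_dist I i a j) b) _ (sz_gt0 j jt) _ _ _ _ _) (leqnn _) _ => //.
      * by move=> s3 ag4; rewrite /= (ag4.1 13%N) // (ag3.1 13%N) // zj.
      * split; last by rewrite /= /upd !eqxx.
        exact: P_upd ndom Jj _.
      * move=> b s3 bj ag4 yb [Jb Mb]; rewrite muln1.
        have s3i : nmem s3 10 0 0 0 = i by rewrite (ag4.1 10%N) // (ag3.1 10%N).
        have s3a : nmem s3 11 0 0 0 = a by rewrite (ag4.1 11%N) // (ag3.1 11%N).
        have s3j : nmem s3 13 0 0 0 = j by rewrite (ag4.1 13%N) // (ag3.1 13%N).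
        apply: (runs_if (Q := _)) => /=; rewrite s3i s3a s3j yb Mb => cmp.
          by apply: runs_skip; rewrite Mb /argmin /= -/(argmin _ b) cmp.
        apply: runs_nset; split.
          by apply: P_upd ndom Jb _ => i' a' j' /=; rewrite s3i s3a s3j.
        by rewrite /= s3i s3a s3j yb /upd !eqxx /argmin /= -/(argmin _ b) (negPf cmp).
      * move=> s3 ag4 [Jb Mb] i' a' j'; move: (Jb i' a' j').
        have [->|//] := eqVneq i' i; rewrite /domj => h.
        case/orP=> [daj|/andP[/eqP ea]]; first by apply: h; rewrite daj.
        rewrite ltnS leq_eqVlt ea => /orP[/eqP->//|j'j].
        by rewrite -ea; apply: h; rewrite ea eqxx j'j orbT.
    by rewrite sum_nat_const card_ord muln1; exact: cost_absorb (sz_gt0 j jt).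
  + by move=> s2 _; apply: P_sub => a' j'; rewrite /dom /domj ltnS leq_eqVlt orbC andb_orl.
- by rewrite sum_nat_const card_ord; exact: leqnn.
Qed.

(** Here [nt] is the whole content of the table, also outside the sampling. Overshooting hops are
    thus covered, and nearness is invoked only later, on valid indices. *)
Lemma runs_track_point : exists C, forall I s i a nt,
  (0 < in_levels I)%N -> (i < in_levels I)%N ->
  nmem s 10 0 0 0 = i -> nmem s 11 0 0 0 = a ->
  (forall i a j, nmem s 2 i a j = nt i a j) ->
  runs I track_point s (C * in_levels I) (fun s' => forall m, (m <= in_levels I)%N ->
    nmem s' 3 m 0 0 = forth nt i a m /\ nmem s' 4 m 0 0 = back nt i a m).
Proof.
eexists=> I s i a nt; set t := in_levels I => t_gt0 it si sa snt.
apply: runs_conseq (runs_seq (Q := _) _) _ (fun _ _ h => h).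
  apply: runs_nset => ag1; apply: (runs_seq (Q := _)).
  apply: runs_nset => ag2.
  apply: runs_conseq (runs_for_pos (b := fun=> 1%N) (J := fun k s' => forall m, (m <= k)%N ->
    nmem s' 3 m 0 0 = forth nt i a m /\ nmem s' 4 m 0 0 = back nt i a m)
    _ t_gt0 _ _ _ _ _) (leqnn _) _ => //.
  - by case=> // _; rewrite /= /upd /= sa.
  - move=> k s1 kt ag; set s2 := State _ _ in ag2 ag => yk Jk.
    have s1i : nmem s1 10 0 0 0 = i by rewrite (ag.1 10%N).
    have snt1 i' a' j' : nmem s1 2 i' a' j' = nt i' a' j' by rewrite (ag.1 2%N) // -snt.
    have [e3 e4] := Jk k (leqnn k); rewrite muln1.
    apply: (runs_seq (Q := _)); apply: runs_nset => ag3; apply: runs_nset => m.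
    rewrite /upd /= /upd /= s1i yk addn1 !snt1 e3 e4 !andbT leq_eqVlt.
    by have [->|_ /Jk//] := eqVneq m k.+1.
by rewrite sum_nat_const card_ord muln1; exact: cost_absorb2 t_gt0.
Qed.

Lemma runs_mark_point : exists C, forall I s i a nt k,
  (0 < in_levels I)%N -> (i < in_levels I)%N ->
  nmem s 10 0 0 0 = i -> nmem s 0 0 0 0 = k ->
  (forall m, (m <= in_levels I)%N ->
    nmem s 3 m 0 0 = forth nt i a m /\ nmem s 4 m 0 0 = back nt i a m) ->
  runs I mark_point s (C * in_levels I) (fun s' => forall j x l, nmem s' 1 j x l =
    if [&& (j < in_levels I)%N, x == track nt i a j & l == k] then 1%N else nmem s 1 j x l).
Proof.
eexists=> I s i a nt k; set t := in_levels I => t_gt0 it si sk sm.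
apply: runs_conseq (runs_for_pos (b := fun=> 1%N) (J := fun j' s' => forall j x l,
  nmem s' 1 j x l =
    if [&& (j < j')%N, x == track nt i a j & l == k] then 1%N else nmem s 1 j x l)
  _ t_gt0 _ _ _ _ _) _ _ => //.
- move=> j' s1 jt ag yj Jj; rewrite muln1.
  have s1i : nmem s1 10 0 0 0 = i by rewrite (ag.1 10%N).
  have s1k : nmem s1 0 0 0 0 = k by rewrite (ag.1 0%N).
  have e3 m : (m <= t)%N -> nmem s1 3 m 0 0 = forth nt i a m.
    by move=> mt; rewrite (ag.1 3%N) // (sm m mt).1.
  have e4 m : (m <= t)%N -> nmem s1 4 m 0 0 = back nt i a m.
    by move=> mt; rewrite (ag.1 4%N) // (sm m mt).2.
  have fin s2 (h : forall j x l, nmem s2 1 j x l =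
      upd (nmem s1) 1 j' (track nt i a j') k 1%N 1 j x l) : forall j x l, nmem s2 1 j x l =
        if [&& (j < j'.+1)%N, x == track nt i a j & l == k] then 1%N else nmem s 1 j x l.
    move=> j x l; rewrite h /upd eqxx /= Jj ltnS [(j <= j')%N]leq_eqVlt.
    by have [->|] := eqVneq j j'; rewrite // ltnn /=.
  apply: (runs_if (Q := _)) => /=; rewrite s1i yj => cmp; apply: runs_nset; apply: fin => j x l;
    rewrite /= s1i yj s1k /track ?cmp ?(negPf cmp) ?e3 ?e4 //; lia.
- by rewrite sum_nat_const card_ord muln1; exact: leqnn.
Qed.
End Labels.
(** * The program *)

Definition sizes (R : realType) (I : input R) : seq nat :=
  mkseq (in_size I) (in_levels I).

(* Label [l] is the [reshape_offset (sizes I) l]-th point of level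
   [reshape_index (sizes I) l], followed through time. *)
Definition label_track (R : realType) (I : input R) (nt : nat -> nat -> nat -> nat)
    (l j : nat) : nat :=
  track nt (reshape_index (sizes I) l) (reshape_offset (sizes I) l) j.

Lemma sumn_sizes (R : realType) (I : input R) :
  sumn (sizes I) = (\sum_(i < in_levels I) in_size I i)%N.
Proof. by rewrite sumnE big_map -(big_mkord xpredT) /index_iota subn0. Qed.

Definition thc_program : cmd :=
  Seq (For 10 NLevels (Seq ultra_level near_level)) all_labels.

Section Program.
Variable R : realType.
Implicit Types (I : input R) (s : state R).

(** Labels are handed out level by level, so the counter at point [a] of level [i] is
    [flatten_index (sizes I) i a]. The additive constant covers a sampling without levels. *)
Lemma runs_all_labels : exists C, forall I s nt,
  (forall i, (i < in_levels I)%N -> (0 < in_size I i)%N) ->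
  nmem s 0 0 0 0 = 0%N -> (forall j x l, nmem s 1 j x l = 0%N) ->
  (forall i a j, nmem s 2 i a j = nt i a j) ->
  runs I all_labels s (C * (sumn (sizes I) * in_levels I) + C) (fun s' =>
    nmem s' 0 0 0 0 = sumn (sizes I) /\
    forall j x l, (j < in_levels I)%N -> (l < sumn (sizes I))%N ->
      nmem s' 1 j x l = (x == label_track I nt l j) :> nat).
Proof.
have [C1 h1] := runs_track_point R; have [C2 h2] := runs_mark_point R.
eexists=> I s nt sz_gt0 sk smark snt; set t := in_levels I; set n := sumn _.
pose J k s' := nmem s' 0 0 0 0 = k /\
  forall j x l, nmem s' 1 j x l = [&& (j < t)%N, (l < k)%N & x == label_track I nt l j] :> nat.
have szE i : (i < t)%N -> nth 0%N (sizes I) i = in_size I i by move=> it; rewrite nth_mkseq.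
have size_sizes : size (sizes I) = t by rewrite size_mkseq.
apply: runs_conseq (runs_for (N := t) (b := fun i => (in_size I i * t)%N)
  (J := fun i => J (flatten_index (sizes I) i 0)) _ _ _ _ _ _) _ _ => //.
- by move=> i it; rewrite muln_gt0 sz_gt0 // (leq_trans _ it).
- by rewrite /J /flatten_index take0; split=> // j x l; rewrite smark andbF.
- move=> i s1 it ag xi Ji.
  have t_gt0 : (0 < t)%N by apply: leq_trans it.
  apply: runs_conseq (runs_for_pos (b := fun=> t) (J := fun a => J (flatten_index (sizes I) i a))
    _ (sz_gt0 i it) _ _ _ Ji _) _ _ => //.
  + by move=> s2 ag2; rewrite /= (ag2.1 10%N) // xi.
  + move=> a s2 a_lt ag2 ya [k2 J2].
    have s2i : nmem s2 10 0 0 0 = i by rewrite (ag2.1 10%N).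
    have snt2 i' a' j' : nmem s2 2 i' a' j' = nt i' a' j'.
      by rewrite (ag2.1 2%N) // (ag.1 2%N) // snt.
    apply: runs_conseq (runs_seq (Q := _) _) _ (fun _ _ h => h).
      apply: runs_conseq (h1 I s2 i a nt t_gt0 it s2i ya snt2) (leqnn _) _ => s3 ag3 tr3 _.
      apply: (runs_seq (Q := _)).
      have s3i : nmem s3 10 0 0 0 = i by rewrite (ag3.1 10%N).
      have s3k : nmem s3 0 0 0 0 = flatten_index (sizes I) i a by rewrite (ag3.1 0%N).
      apply: runs_conseq (h2 I s3 i a nt _ t_gt0 it s3i s3k tr3) (leqnn _) _ => s4 ag4 mk _.
      apply: runs_nset; split.
        by rewrite /= (ag4.1 0%N) // s3k /upd !eqxx addn1 /flatten_index addnS.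
      move=> j x l; rewrite /= /upd /= mk (ag3.1 1%N) // J2 /flatten_index addnS ltnS.
      rewrite -!/(flatten_index _ _ _) [(l <= _)%N]leq_eqVlt.
      have [->|] := eqVneq l (flatten_index (sizes I) i a); last by rewrite !andbF.
      (* The label placed in this round decodes to the pair [(i, a)]. *)
      rewrite ltnn andbF andbT /= /label_track flatten_indexKl ?flatten_indexKr ?szE //.
    exact: cost_absorb3 t_gt0.
  + by rewrite sum_nat_const card_ord; exact: leqnn.
  (* The counter after the last point of level [i] is that of the first point of level [i.+1]. *)
  + move=> s2 _; rewrite /flatten_index addn0 (take_nth 0%N) ?size_sizes //.
    by rewrite sumn_rcons szE.
- rewrite -big_distrl -sumn_sizes /=.
  by apply: leq_add; [exact: leqnn | exact: leq_addl].
- move=> s' _; rewrite /flatten_index addn0 take_oversize ?size_sizes // => -[sk' mk].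
  by split=> // j x l jt ln; rewrite mk jt ln.
Qed.
End Program.
(** A level with [m] points costs a multiple of [m ^ 3 + m * n], hence of [m * n ^ 2], and these
    weights add up to [n ^ 3]. *)
Lemma runs_thc_program (R : realType) : exists C, forall I : input R,
  (forall i, (i < in_levels I)%N -> (0 < in_size I i)%N) ->
  runs I thc_program (init_state R) (C * sumn (sizes I) ^ 3 + C) (fun s =>
    [/\ forall i a b, (i < in_levels I)%N -> (a < in_size I i)%N -> (b < in_size I i)%N ->
          rmem s 0 i a b = ultra (slice I i) (in_size I i) a b,
        nmem s 0 0 0 0 = sumn (sizes I)
      & exists nt, (forall i a j, (i < in_levels I)%N -> (a < in_size I i)%N ->
            (j < in_levels I)%N -> nt i a j = near I i a j) /\
          forall j x l, (j < in_levels I)%N -> (l < sumn (sizes I))%N ->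
            nmem s 1 j x l = (x == label_track I nt l j) :> nat]).
Proof.
have [C1 h1] := runs_ultra_level R; have [C2 h2] := runs_near_level R.
have [C3 h3] := runs_all_labels R.
eexists=> I sz_gt0; rewrite sumn_sizes; set t := in_levels I; set n := (\sum_(i < t) _)%N.
have t_le_n : (t <= n)%N.
  rewrite -[t]card_ord -sum1_card; apply: leq_sum => i _; exact: sz_gt0.
have sz_le i : (i < t)%N -> (in_size I i <= n)%N.
  by move=> it; rewrite /n (bigD1 (Ordinal it)) //= leq_addr.
apply: runs_conseq (runs_seq (Q := _) _) _ (fun _ _ h => h).
  apply: runs_conseq (runs_for (N := t) (b := fun i => (in_size I i * (n * n))%N)
    (J := fun i s' => (forall i' a b, (i' < i)%N -> (a < in_size I i')%N -> (b < in_size I i')%N ->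
        rmem s' 0 i' a b = ultra (slice I i') (in_size I i') a b) /\
      (forall i' a j, (i' < i)%N -> (a < in_size I i')%N -> (j < t)%N ->
        nmem s' 2 i' a j = near I i' a j)) _ _ _ _ _ _) (leqnn _) _ => //.
  - move=> i it; rewrite !muln_gt0 andbb sz_gt0 //=.
    by apply: leq_trans t_le_n; exact: leq_trans it.
  - move=> i s1 it ag xi [Ju Jn].
    have sz0 := sz_gt0 i it; have t0 : (0 < t)%N by apply: leq_trans it.
    have n0 : (0 < n)%N by apply: leq_trans t_le_n.
    apply: runs_conseq (runs_seq (Q := _) _) _ (fun _ _ h => h).
      apply: runs_conseq (h1 I i _ s1 sz0 erefl xi) (leqnn _) _ => s2 ag2 u2 _.
      have s2i : nmem s2 10 0 0 0 = i by rewrite (ag2.1 10%N).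
      apply: runs_conseq (h2 I i s2 t0 sz_gt0 it s2i) (leqnn _) _ => s3 ag3 n3; split.
        move=> i' a b; rewrite ltnS leq_eqVlt (ag3.2 0%N) // u2.
        have [-> _ -> -> //|_ /= i'i az bz] := eqVneq i' i.
        exact: Ju.
      move=> i' a j; rewrite ltnS leq_eqVlt; have := n3 i' a j.
      have [-> h _ az jt|_ -> /= i'i az jt] := eqVneq i' i.
        by apply: h; rewrite az jt.
      by rewrite (ag2.1 2%N) // Jn.
    rewrite -/t -/n; set m := in_size I i.
    have le1 : (m * m * m <= m * (n * n))%N by rewrite -mulnA leq_mul2l leq_mul ?sz_le ?orbT.
    have le2 : (m * n <= m * (n * n))%N by rewrite leq_mul2l leq_pmulr ?orbT.
    have le3 : (0 < m * (n * n))%N by rewrite !muln_gt0 sz0 n0.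
    apply: leq_trans (_ : (C1 + C2 + 1) * (m * (n * n)) <= _)%N; last exact: leqnn.
    rewrite !mulnDl mul1n -addn1; apply: leq_add => //.
    by apply: leq_add; rewrite leq_mul2l ?le1 ?le2 orbT.
  (* The witness for [nt] is what the first loop left in array 2. *)
  - move=> s1 ag [u1 n1] ag0; have lab := h3 I s1 (nmem s1 2) sz_gt0.
    apply: runs_conseq (lab _ _ _) (leqnn _) _ => //.
    + by rewrite (ag.1 0%N).
    + by move=> j x l; rewrite (ag.1 1%N).
    + move=> s2 ag2 [k2 mk2]; rewrite /n -sumn_sizes; split=> //; last by exists (nmem s1 2).
      by move=> i a b it az bz; rewrite (ag2.2 0%N) // u1.
rewrite -big_distrl /= -/n sumn_sizes -/t -/n (mulnn n) -expnS.
have : (n * t <= n ^ 3)%N.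
  by case: (n) t_le_n => // m tm; rewrite expnS leq_mul2l (leq_trans tm) ?orbT // leq_pmulr.
move: (n ^ 3)%N (n * t)%N => N1 N2 le12.
apply: leq_trans (_ : (C1 + C2 + 1 + (ncost NLevels + 20) + C3 + (ncost NLevels + 20) + 1) * N1
  + (C1 + C2 + 1 + (ncost NLevels + 20) + C3 + (ncost NLevels + 20) + 1) <= _)%N; last exact: leqnn.
have := leq_mul (leqnn C3) le12; rewrite !mulnDl; lia.
Qed.

(** * Optimality of the ultrametrics *)

Section Bottleneck.
Variables (R : realType) (d : nat -> nat -> R).
Hypotheses (d_ge0 : forall a b, 0 <= d a b) (d_xx : forall a, d a a = 0)
  (d_sym : forall a b, d a b = d b a).

Lemma bneckS c a b :
  bneck d c.+1 a b = Num.min (bneck d c a b) (Num.max (bneck d c a c) (bneck d c c b)).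
Proof. by []. Qed.

Lemma bneck_ge0 c a b : 0 <= bneck d c a b.
Proof.
by elim: c a b => [|c IH] a b; rewrite ?bneckS ?d_ge0 // le_min IH le_max IH.
Qed.

Lemma bneck_xx c a : bneck d c a a = 0.
Proof.
by elim: c a => [|c IH] a; rewrite ?bneckS ?d_xx // IH min_l // le_max bneck_ge0.
Qed.

Lemma bneck_sym c a b : bneck d c a b = bneck d c b a.
Proof. by elim: c a b => [|c IH] a b; rewrite ?bneckS ?d_sym // IH maxC !(IH c). Qed.

Lemma bneck_le c a b : bneck d c a b <= d a b.
Proof. by elim: c a b => [|c IH] a b //; rewrite bneckS ge_min IH. Qed.

(* The pivot [c] changes neither its own row nor its own column. *)
Lemma bneck_ultra n c a b : (c < n)%N ->
  bneck d n a b <= Num.max (bneck d n a c) (bneck d n c b).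
Proof.
elim: n a b => // n IH a b; rewrite ltnS leq_eqVlt => /orP[/eqP->|cn].
  rewrite !bneckS !bneck_xx !(max_l (bneck_ge0 _ _ _), max_r (bneck_ge0 _ _ _)) !minxx.
  by rewrite ge_min lexx orbT.
have h1 := IH a b cn; have h2 := IH a n cn; have h3 := IH n b cn.
move: h1 h2 h3; rewrite !bneckS.
move: (bneck d n a b) (bneck d n a c) (bneck d n c b) (bneck d n a n) (bneck d n n b)
  (bneck d n n c) (bneck d n c n) => x y z u v w w'.
move=> h1 h2 h3; rewrite ge_min ge_max.
(* Four cases, by which of the legs [a] to [c] and [c] to [b] pass through the new pivot [n]. If
   none does, [h1] concludes; otherwise the route from [a] to [b] through [n] is good enough. *)
have [_|yw] := leP y (Num.max u w); have [_|zw] := leP z (Num.max w' v).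
- by rewrite h1.
- move: zw h2; rewrite !(le_max, gt_max) => /andP[_ _] /orP[->|->];
    by rewrite ?lexx ?orbT /= ?lexx ?orbT.
- move: yw h3; rewrite !(le_max, gt_max) => /andP[_ _] /orP[->|->];
    by rewrite ?lexx ?orbT /= ?lexx ?orbT.
- by rewrite !le_max !lexx !orbT.
Qed.

(** Along a path, an ultrametric is at most its largest value on an edge, which exceeds the length
    of that edge by at most [chi]. *)
Lemma bneck_fit (nu : nat -> nat -> R) (chi : R) n c a b :
  (forall a b c, (a < n)%N -> (b < n)%N -> (c < n)%N ->
     nu a b <= Num.max (nu a c) (nu c b)) ->
  (forall a b, (a < n)%N -> (b < n)%N -> `|d a b - nu a b| <= chi) ->
  (c <= n)%N -> (a < n)%N -> (b < n)%N -> nu a b <= bneck d c a b + chi.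
Proof.
move=> nu_ultra nu_d; elim: c a b => [|c IH] a b cn an bn.
  by have := nu_d a b an bn; rewrite ler_norml => /andP[h _]; rewrite /bneck /=; lra.
have le1 := IH a b (ltnW cn) an bn.
have le2 := IH a c (ltnW cn) an cn; have le3 := IH c b (ltnW cn) cn bn.
have := nu_ultra a b c an bn cn.
rewrite bneckS addr_minl addr_maxl le_min le1 /= !le_max => /orP[h|h].
  by rewrite (le_trans h le2).
by rewrite (le_trans h le3) orbT.
Qed.

Section Distortion.
Variable n : nat.
Let g a b := (d a b - bneck d n a b) / 2.

(** The fold is nested, so the argument for a maximum is made for one row and then for the
    succession of rows. *)
Lemma distortion_bounds :
  [/\ 0 <= distortion d n,
      forall a b, (a < n)%N -> (b < n)%N -> g a b <= distortion d n
    & forall chi, 0 <= chi -> (forall a b, (a < n)%N -> (b < n)%N -> g a b <= chi) ->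
        distortion d n <= chi].
Proof.
pose row a (e : R) m := iteri m (fun b e => Num.max e (g a b)) e.
have rowP a e m : [/\ e <= row a e m, forall b, (b < m)%N -> g a b <= row a e m
    & forall chi, e <= chi -> (forall b, (b < m)%N -> g a b <= chi) -> row a e m <= chi].
  elim: m => [|m [e_le g_le le_chi]]; first by split.
  split=> /= [|b|chi e_chi g_chi]; rewrite -/(row a e m).
  - by rewrite le_max e_le.
  - by rewrite ltnS leq_eqVlt le_max => /orP[/eqP->|/g_le->//]; rewrite lexx orbT.
  - by rewrite ge_max g_chi // le_chi // => b bm; rewrite g_chi // ltnW.
have colP m : [/\ 0 <= iteri m (fun a e => row a e n) 0,
    forall a b, (a < m)%N -> (b < n)%N -> g a b <= iteri m (fun a e => row a e n) 0
  & forall chi, 0 <= chi -> (forall a b, (a < m)%N -> (b < n)%N -> g a b <= chi) ->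
      iteri m (fun a e => row a e n) 0 <= chi].
  elim: m => [|m [ge0 g_le le_chi]]; first by split.
  rewrite iteriS; set e := iteri m _ _; have [r1 r2 r3] := rowP m e n.
  split=> [|a b|chi chi0 g_chi].
  - exact: le_trans ge0 r1.
  - rewrite ltnS leq_eqVlt => /orP[/eqP->|am bn]; first exact: r2.
    exact: le_trans (g_le a b am bn) r1.
  - apply: r3 => [|b bn]; last exact: g_chi.
    by apply: le_chi => // a b am bn; apply: g_chi; rewrite // ltnW.
exact: colP.
Qed.

(** Adding one nonnegative constant commutes with the maximum, so the inequality for [bneck]
    survives; coinciding points, where the constant is absent, are treated first. *)
Lemma ultra_pseudo_ultrametric a b c : (c < n)%N ->
  [/\ 0 <= ultra d n a b, ultra d n a a = 0, ultra d n a b = ultra d n b a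
    & ultra d n a b <= Num.max (ultra d n a c) (ultra d n c b)].
Proof.
move=> cn; have [e0 _ _] := distortion_bounds.
have u0 x y : 0 <= ultra d n x y by rewrite /ultra; case: ifP => // _; rewrite addr_ge0 ?bneck_ge0.
split=> //.
- by rewrite /ultra eqxx.
- by rewrite /ultra eq_sym bneck_sym.
- have [->|ac] := eqVneq a c; first by rewrite le_max lexx orbT.
  have [->|cb] := eqVneq c b; first by rewrite le_max lexx.
  have [->|ab] := eqVneq a b; first by rewrite {1}/ultra eqxx le_max u0.
  rewrite /ultra (negPf ac) (negPf cb) (negPf ab) -addr_maxl lerD2r.
  exact: bneck_ultra.
Qed.

Lemma ultra_fit (nu : nat -> nat -> R) (chi : R) a b :
  (forall a b c, (a < n)%N -> (b < n)%N -> (c < n)%N ->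
     nu a b <= Num.max (nu a c) (nu c b)) ->
  (forall a b, (a < n)%N -> (b < n)%N -> `|d a b - nu a b| <= chi) ->
  (a < n)%N -> (b < n)%N -> `|d a b - ultra d n a b| <= chi.
Proof.
move=> nu_ultra nu_d an bn; have chi0 : 0 <= chi by apply: le_trans (nu_d a b an bn).
have [e0 e_ge e_le] := distortion_bounds.
(* From [d <= nu + chi] and [nu <= bneck + chi], half of [d - bneck] is at most [chi]. *)
have e_chi : distortion d n <= chi.
  apply: e_le => // x y xn yn; have := bneck_fit nu_ultra nu_d (leqnn n) xn yn.
  by have := nu_d x y xn yn; rewrite ler_norml /g => /andP[_ h1] h2; lra.
rewrite /ultra; case: eqP => [->|_]; first by rewrite d_xx subrr normr0.
(* The gap [d - bneck] lies between 0 and twice the distortion; subtracting the distortion centers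
   it. *)
have := e_ge a b an bn; have := bneck_le n a b; rewrite /g ler_norml => h1 h2.
by apply/andP; split; lra.
Qed.
End Distortion.
End Bottleneck.
(** * Correctness of the labels *)

Section Tracks.
Variables (t : nat) (sz : nat -> nat) (nt : nat -> nat -> nat -> nat).
Hypothesis nt_lt : forall i a j, (i < t)%N -> (a < sz i)%N -> (j < t)%N -> (nt i a j < sz j)%N.

Lemma track_self i a : track nt i a i = a.
Proof. by rewrite /track leqnn subnn. Qed.

Lemma track_forth i a j : (i <= j)%N -> track nt i a j.+1 = nt j (track nt i a j) j.+1.
Proof. by move=> ij; rewrite /track ij leqW // subSn // /forth iteriS addnS subnKC. Qed.

Lemma track_back i a j : (j < i)%N -> track nt i a j = nt j.+1 (track nt i a j.+1) j.
Proof.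
(* If [j.+1 = i], [track] takes its forward branch, but with no hop, which agrees with the backward
   one. *)
move=> ji; have -> : track nt i a j.+1 = back nt i a (i - j.+1).
  rewrite /track; case: leqP => // ij; have -> : i = j.+1 by apply/eqP; rewrite eqn_leq ij.
  by rewrite subnn.
rewrite /track leqNgt ji /= -[(i - j)%N]prednK ?subn_gt0 // -subnS /back iteriS.
by congr (nt _ _ _); lia.
Qed.

Lemma track_lt i a j : (i < t)%N -> (a < sz i)%N -> (j < t)%N -> (track nt i a j < sz j)%N.
Proof.
move=> it az jt; case: (leqP i j) => ij.
  elim: j ij jt => [|j IH]; first by rewrite leqn0 => /eqP <-; rewrite track_self.
  rewrite leq_eqVlt => /orP[/eqP<-|ij jt]; first by rewrite track_self.
  by rewrite track_forth // nt_lt ?IH // ltnW.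
move: {2}(i - j)%N (erefl (i - j)%N) => m; elim: m j jt ij => [|m IH] j jt ij ijm.
  by move: ijm; lia.
rewrite track_back // nt_lt //; try lia.
have [->|ne] := eqVneq j.+1 i; first by rewrite track_self.
by apply: IH; lia.
Qed.
End Tracks.

(** * Labelings as surjections from labels to points *)

Section Fibers.
Variables (R : realType) (M : metricType R) (k : nat).

(** The blocks are the fibers of [f]: disjoint and covering because [f] is a function, nonempty
    because it is onto. *)
Lemma is_labeling_fibers (Q : {fset M}) (L : Q -> {set 'I_k}) (f : 'I_k -> Q) :
  (forall p j, (j \in L p) = (f j == p)) -> (forall p, exists j, f j = p) ->
  is_labeling L.
Proof.
move=> Lf f_surj.
have set0L : set0 \notin [set L p | p : Q].
  apply/imsetP => -[p _ /setP e]; have [j fj] := f_surj p.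
  by have := e j; rewrite inE Lf fj eqxx.
have [trivL injL] : trivIset [set L p | p : Q] /\ {in predT &, injective L}.
  apply: trivIimset => // p q _ _ qp; apply/pred0P => j /=; rewrite !Lf.
  by apply/negP => /andP[/eqP-> /eqP pq]; rewrite pq eqxx in qp.
split; last by move=> p q; apply: injL.
apply/and3P; split=> //; apply/eqP/setP => j; rewrite inE.
by apply/bigcupP; exists (L (f j)); rewrite ?Lf ?imset_f.
Qed.

Lemma contiguous_fibers delta (Q1 Q2 : {fset M}) (L1 : Q1 -> {set 'I_k})
    (L2 : Q2 -> {set 'I_k}) (f1 : 'I_k -> Q1) (f2 : 'I_k -> Q2) :
  (forall p j, (j \in L1 p) = (f1 j == p)) -> (forall p j, (j \in L2 p) = (f2 j == p)) ->
  (forall j, mdist (val (f1 j)) (val (f2 j)) <= delta) ->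
  contiguous delta L1 L2.
Proof.
move=> e1 e2 near12; split=> u; apply/subsetP => j; rewrite ?e1 ?e2 => /eqP <-.
  by apply/bigcupP; exists (f2 j); rewrite ?e2.
by apply/bigcupP; exists (f1 j); rewrite ?e1 // metric_sym.
Qed.

(** Blocks are nonempty, and any label of a point must be carried by a point of the other level
    within [delta]. *)
Lemma contiguous_near delta (Q1 Q2 : {fset M}) (L1 : Q1 -> {set 'I_k})
    (L2 : Q2 -> {set 'I_k}) :
  is_labeling L1 -> is_labeling L2 -> contiguous delta L1 L2 ->
  (forall u : Q1, exists v : Q2, mdist (val u) (val v) <= delta) /\
  (forall v : Q2, exists u : Q1, mdist (val v) (val u) <= delta).
Proof.
have ne (Q : {fset M}) (L : Q -> {set 'I_k}) p : is_labeling L -> exists j, j \in L p.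
  move=> [/and3P[_ _ n0] _]; apply/set0Pn; apply: contraNneq n0 => <-.
  exact: imset_f.
move=> lab1 lab2 [c1 c2]; split=> u.
  have [j ju] := ne _ _ u lab1.
  by have /bigcupP[v le _] := subsetP (c1 u) j ju; exists v.
have [j ju] := ne _ _ u lab2.
by have /bigcupP[v le _] := subsetP (c2 u) j ju; exists v.
Qed.
End Fibers.

(** * From machine tables back to the metric space *)

Section Encoding.
Variables (R : realType) (M : metricType R) (t : nat) (P : 'I_t -> {fset M})
  (pts : 'I_t -> seq M).
Hypotheses (P_ne : temporal_sampling P) (ptsP : enumerates pts P).
Let I := encode pts.
Let ix (i : 'I_t) (p : P i) := index (val p) (pts i).

Lemma encode_size (i : 'I_t) : in_size I i = size (pts i).
Proof. by rewrite /= valK. Qed.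

Lemma ix_lt (i : 'I_t) (p : P i) : (ix p < in_size I i)%N.
Proof. by rewrite encode_size index_mem (ptsP i).2 fsvalP. Qed.

Lemma encode_dist (i j : 'I_t) (p : P i) (q : P j) :
  in_dist I i (ix p) j (ix q) = mdist (val p) (val q).
Proof.
have pt (k : 'I_t) (r : P k) : point_of pts k (ix r) = Some (val r).
  rewrite /point_of valK /= onthE (nth_map (val r)).
    by rewrite nth_index // (ptsP k).2 fsvalP.
  by rewrite index_mem (ptsP k).2 fsvalP.
by rewrite /= !pt.
Qed.

Lemma sampling_sizeE : sampling_size P = sumn (sizes I).
Proof.
rewrite sumn_sizes; apply: eq_bigr => i _; rewrite encode_size.
apply/esym/perm_size/uniq_perm; rewrite ?fset_uniq ?(ptsP i).1 //.
exact: (ptsP i).2.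
Qed.

(** An inverse of the numbering [ix], total thanks to a default point of each nonempty level. *)
Lemma encode_point : exists pt : forall i : 'I_t, nat -> P i,
  (forall (i : 'I_t) a, (a < in_size I i)%N -> ix (pt i a) = a) /\
  (forall i (p : P i), pt i (ix p) = p).
Proof.
have p0 i : P i := FSetSub (xchooseP (elimT (fset0Pn _) (P_ne i))).
exists (fun i a => insubd (p0 i) (nth (val (p0 i)) (pts i) a)); split=> [i a|i p].
  rewrite encode_size => ai; have mem : nth (val (p0 i)) (pts i) a \in P i.
    by rewrite -(ptsP i).2 mem_nth.
  by rewrite /ix val_insubd mem index_uniq // (ptsP i).1.
apply: val_inj; rewrite val_insubd nth_index ?fsvalP //.
by rewrite (ptsP i).2 fsvalP.
Qed.

Lemma encode_gt0 i : (i < t)%N -> (0 < in_size I i)%N.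
Proof.
move=> it; have /fset0Pn[x xP] := P_ne (Ordinal it).
exact: leq_trans (ix_lt (FSetSub xP : P (Ordinal it))).
Qed.

(** The oracle answers 0 about missing points, so these laws hold at all indices, as the bottleneck
    lemmas assume. *)
Lemma slice_encode i :
  [/\ forall a b, 0 <= slice I i a b, forall a, slice I i a a = 0
    & forall a b, slice I i a b = slice I i b a].
Proof.
split=> [a b|a|a b]; rewrite /slice /=.
- by case: (point_of pts i a) => // x; case: (point_of pts i b) => // y; exact: mdist_ge0.
- by case: (point_of pts i a) => // x; exact: mdistxx.
- case: (point_of pts i a) (point_of pts i b) => [x|] [y|] //; exact: metric_sym.
Qed.

Lemma ultra_encode (i : 'I_t) (chi : R) (mu : P i -> P i -> R) : 0 <= chi ->
  pseudo_ultrametric mu -> Linfty (@mrestr R M (P i)) mu <= chi ->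
  let u p q := ultra (slice I i) (in_size I i) (ix p) (ix q) in
  pseudo_ultrametric u /\ Linfty (@mrestr R M (P i)) u <= chi.
Proof.
move=> chi0 [_ mu_ultra] mu_fit u.
have [d_ge0 d_xx d_sym] := slice_encode i; have [pt [ptK ixK]] := encode_point.
have uP (p q r : P i) := ultra_pseudo_ultrametric d_ge0 d_xx d_sym (ix p) (ix q) (ix_lt r).
have mu_le p q : `|mdist (val p) (val q) - mu p q| <= chi.
  apply: le_trans mu_fit; apply: le_trans (le_bigmax _ _ p).
  exact: (le_bigmax _ (fun q => `|mrestr p q - mu p q|)).
split; first split.
- split=> [p q|p|p q|p q r].
  + by have [] := uP p q p.
  + by have [] := uP p p p.
  + by have [] := uP p q p.
  + have [_ _ _ ut] := uP p q r; have [h1 _ _ _] := uP p r p; have [h2 _ _ _] := uP r q p.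
    by apply: le_trans ut _; rewrite ge_max lerDl lerDr h1 h2.
- by move=> p q r; have [] := uP p q r.
apply/bigmax_leP; split=> // p _; apply/bigmax_leP; split=> // q _.
rewrite /mrestr /u -encode_dist -[in_dist _ _ _ _ _]/(slice I i (ix p) (ix q)).
(* The competitor [mu] is transported to indices through [pt]. *)
apply: (ultra_fit d_xx (nu := fun a b => mu (pt i a) (pt i b))); rewrite ?ix_lt //.
by move=> a b an bn; rewrite -{1}(ptK i a an) -{1}(ptK i b bn) /slice encode_dist mu_le.
Qed.

Section Labels.
Variables (s : state R) (nt : nat -> nat -> nat -> nat).
Hypotheses (k_size : out_k s = sumn (sizes I))
  (nt_near : forall i a j, (i < t)%N -> (a < in_size I i)%N -> (j < t)%N ->
     nt i a j = near I i a j)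
  (marks : forall j x l, (j < t)%N -> (l < sumn (sizes I))%N ->
     nmem s 1 j x l = (x == label_track I nt l j) :> nat).

Lemma label_track_lt l j : (l < sumn (sizes I))%N -> (j < t)%N ->
  (label_track I nt l j < in_size I j)%N.
Proof.
move=> ln jt; have rt : (reshape_index (sizes I) l < t)%N.
  by have := reshape_indexP ln; rewrite size_mkseq.
apply: (@track_lt t (in_size I) nt) => //.
  move=> i a m it az mt; rewrite nt_near //.
  by have [] := argminP (in_dist I i a m) (encode_gt0 mt).
by have := reshape_offsetP ln; rewrite nth_mkseq.
Qed.

(** One of the two positions is a nearest point to the other: the later one if the label starts at
    level [i] or before, the earlier one if it starts after [i]. Some point within [delta] exists,
    so the nearest one is within [delta] too. *)
Lemma label_track_near delta (i j : 'I_t) l : j = i.+1 :> nat -> (l < sumn (sizes I))%N ->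
  (forall u : P i, exists v : P j, mdist (val u) (val v) <= delta) ->
  (forall v : P j, exists u : P i, mdist (val v) (val u) <= delta) ->
  in_dist I i (label_track I nt l i) j (label_track I nt l j) <= delta.
Proof.
move=> ij ln near_ij near_ji; have [pt [ptK _]] := encode_point.
have li := label_track_lt ln (ltn_ord i); have lj := label_track_lt ln (ltn_ord j).
have nearest (a b : 'I_t) x : (x < in_size I a)%N ->
    (exists v : P b, mdist (val (pt a x)) (val v) <= delta) ->
    in_dist I a x b (nt a x b) <= delta.
  move=> xa [v le_v]; rewrite nt_near //; apply: le_trans le_v; rewrite -encode_dist ptK //.
  have [_ h] := argminP (in_dist I a x b) (encode_gt0 (ltn_ord b)).
  by apply: h; exact: ix_lt.
case: (leqP (reshape_index (sizes I) l) i) => ri.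
  have -> : label_track I nt l j = nt i (label_track I nt l i) j.
    by rewrite /label_track ij track_forth.
  by apply: nearest => //; exact: near_ij.
have e : label_track I nt l i = nt j (label_track I nt l j) i.
  by rewrite /label_track ij track_back.
rewrite -(ptK i _ li) -(ptK j _ lj) encode_dist metric_sym -encode_dist !ptK // e.
by apply: nearest => //; exact: near_ji.
Qed.

Lemma out_label_fibers : exists f : forall i, 'I_(out_k s) -> P i,
  (forall i p j, (j \in @out_label R M t pts P s i p) = (f i j == p)) /\
  (forall i j, ix (f i j) = label_track I nt j i).
Proof.
have [pt [ptK ixK]] := encode_point.
have ln (l : 'I_(out_k s)) : (l < sumn (sizes I))%N by rewrite -k_size.
exists (fun i l => pt i (label_track I nt l i)); split=> [i p l|i l].
  rewrite inE marks // eqb0 negbK; apply/eqP/eqP => [<-|<-]; first exact: ixK.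
  by rewrite [index _ _]ptK // label_track_lt.
by rewrite ptK // label_track_lt.
Qed.

(** Every point carries at least the label created at it, since a track is at its origin on its own
    level. *)
Lemma out_label_labeling (i : 'I_t) : is_labeling (@out_label R M t pts P s i).
Proof.
have [f [f_label f_ix]] := out_label_fibers; have [pt [ptK ixK]] := encode_point.
apply: (is_labeling_fibers (f := f i)) => // p.
have p_lt : (ix p < nth 0 (sizes I) i)%N by rewrite nth_mkseq // ix_lt.
have ln := flatten_indexP p_lt; rewrite -k_size in ln.
exists (Ordinal ln); rewrite -[LHS]ixK f_ix /label_track flatten_indexKl //.
by rewrite flatten_indexKr // track_self ixK.
Qed.

Lemma out_label_contiguous delta (i j : 'I_t) : j = i.+1 :> nat ->
  (forall u : P i, exists v : P j, mdist (val u) (val v) <= delta) ->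
  (forall v : P j, exists u : P i, mdist (val v) (val u) <= delta) ->
  contiguous delta (@out_label R M t pts P s i) (@out_label R M t pts P s j).
Proof.
move=> ij near_ij near_ji; have [f [f_label f_ix]] := out_label_fibers.
apply: (contiguous_fibers (f1 := f i) (f2 := f j)) => // l.
by rewrite -encode_dist !f_ix; apply: label_track_near; rewrite // -k_size.
Qed.
End Labels.
End Encoding.

Theorem theorem8 (R : realType) :
  exists (prog : cmd) (c : nat),
    forall (M : metricType R) (t : nat) (P : 'I_t -> {fset M})
           (pts : 'I_t -> seq M),
      temporal_sampling P -> enumerates pts P ->
      exists (T : nat) (s : state R),
        [/\ exec (encode pts) prog (init_state R) T s,
            (T <= c * sampling_size P ^ 3 + c)%N
          & forall chi delta : R, 0 <= chi -> 0 <= delta ->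
              admits_thc chi delta P ->
              temporal_hierarchical_clustering chi delta
                (@out_mu R M t pts P s) (@out_label R M t pts P s)].
Proof.
have [C run] := runs_thc_program R; exists thc_program, C => M t P pts P_ne ptsP.
have [T [s [ex le [mus k_size [nt [nt_near marks]]]]]] := run (encode pts) (encode_gt0 P_ne ptsP).
exists T, s; split=> //; first by rewrite (sampling_sizeE ptsP).
(* The final state is already fixed here; the given clustering only certifies that its output meets
   these bounds. *)
move=> chi delta chi0 _ [mu [k [L [mu_ultra mu_fit _ labL contL]]]].
have out_muE (i : 'I_t) : @out_mu R M t pts P s i =
    fun p q => ultra (slice (encode pts) i) (in_size (encode pts) i)
      (index (val p) (pts i)) (index (val q) (pts i)).
  by apply/funext => p; apply/funext => q; rewrite /out_mu mus //; exact: ix_lt.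
have U i := ultra_encode P_ne ptsP chi0 (mu_ultra i) (mu_fit i).
split=> [i|i||i|i j ij].
- by rewrite out_muE; have [] := U i.
- by rewrite out_muE; have [] := U i.
- by rewrite (sampling_sizeE ptsP) -k_size.
- exact: (out_label_labeling P_ne ptsP k_size nt_near marks).
- have [ij_near ji_near] := contiguous_near (labL i) (labL j) (contL i j ij).
  exact: (out_label_contiguous P_ne ptsP k_size nt_near marks).
Qed.
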